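(* Let $h>0$ and $\beta>0$. For all $j\in\mathbf E$ and $\lambda>0$, the Laplace transform $\Delta_{j0}(\lambda)=\int_0^\infty e^{-\lambda t}d_{j0}(t)\,dt$ of the density $d_{j0}$ of the first effective catastrophe time $C_{j0}$ satisfies $$\Delta_{j0}(\lambda)=\frac{\beta}{\lambda+\beta}-\frac{\lambda}{\lambda+\beta}\cdot\frac{\beta\tilde r_{j0}(\lambda+\beta)}{1-\beta\tilde r_{00}(\lambda+\beta)}.$$
   Context: Let $\mathbf E=\{0,1,2,\dots\}$ and let $c\ge 1$ be an integer (the number of servers). Let $(b_j)_{j\ge0}$ be reals with $b_j\ge 0$ for $j\ne 1$, $0<-b_1=\sum_{j\ne1}b_j<\infty$, $b_0>0$ and $\sum_{j\ge2}b_j>0$. Let $\beta>0$ and $h_j\ge0$ ($j\ge1$) with $0<h:=\sum_{j\ge1}h_j<\infty$. The queue with resurrection (no catastrophes) has conservative bounded $q$-matrix $\tilde Q$ on $\mathbf E$: for $i\ge1$, $\tilde q_{i,i-1}=\min(i,c)b_0$, $\tilde q_{ii}=b_1-[\min(i,c)-1]b_0$, $\tilde q_{ij}=b_{j-i+1}$ ($j\ge i+1$); $\tilde q_{00}=-h$, $\tilde q_{0j}=h_j$ ($j\ge1$); other entries $0$. Its transition function is $(\tilde p_{ij}(t))$ and $\tilde r_{ij}(\lambda)=\int_0^\infty e^{-\lambda t}\tilde p_{ij}(t)\,dt$. The queue with resurrection and catastrophes moves as $\tilde Q$ and in addition jumps from each state $i\ge1$ to $0$ at rate $\beta$ (a catastrophe;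 it is ''effective'' since the state is positive). $C_{j0}$ is the first occurrence time of an effective catastrophe when starting from $j$. Formally, let $\{M_t\}$ be the Markov chain on $\mathbf S=\{-1,0,1,\dots\}$ with $q$-matrix whose off-diagonal entries among states of $\mathbf E$ are those of $\tilde Q$, with additional jumps from each $i\ge1$ to $-1$ at rate $\beta$, and $-1$ absorbing (conservative); then $C_{j0}$ is the hitting time of $-1$ by $M$ with $M_0=j$, and $P(C_{j0}>t)=\int_t^\infty d_{j0}(\tau)\,d\tau$. *)

(* Defs.v *)
From HB Require Import structures.
From mathcomp Require Import all_boot all_order all_algebra.
From mathcomp Require Import all_classical all_reals all_analysis.
Set Implicit Arguments.
Unset Strict Implicit.
Unset Printing Implicit Defensive.
Import Order.TTheory GRing.Theory Num.Theory.
Import numFieldNormedType.Exports.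
Local Open Scope classical_set_scope.
Local Open Scope ring_scope.

(* Time is a real number; nothing is required at negative times. *)

(* A standard (possibly dishonest) transition function on a countable set. *)
Record transition_function (R : realType) (S : countType)
    (p : S -> S -> R -> R) : Prop := TransitionFunction {
  tf_ge0 : forall i j t, 0 <= t -> 0 <= p i j t ;
  tf_row : forall i t, 0 <= t ->
    (\esum_(j in [set: S]) (p i j t)%:E <= 1)%E ;
  tf_zero : forall i j, p i j 0 = (i == j)%:R ;
  tf_chapman_kolmogorov : forall i j s t, 0 <= s -> 0 <= t ->
    ((p i j (s + t))%:E = \esum_(k in [set: S]) (p i k s * p k j t)%:E)%E ;
  tf_standard : forall i j, p i j t @[t --> 0^'+] --> ((i == j)%:R : R)
}.

(* q is the right derivative of p at time 0, entry by entry. *)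
Definition has_q_matrix (R : realType) (S : countType)
    (p : S -> S -> R -> R) (q : S -> S -> R) : Prop :=
  forall i j, (p i j t - (i == j)%:R) / t @[t --> 0^'+] --> q i j.

(* The q-matrix of the queue with resurrection. Here h = \sum_(j >= 1) hs j;
   hs 0 is never used. *)
Definition qtilde (R : realType) (c : nat) (b hs : nat -> R) (h : R)
    (i j : nat) : R :=
  if i == 0%N then (if j == 0%N then - h else hs j)
  else if j == i then b 1%N - ((minn i c)%:R - 1) * b 0%N
  else if j.+1 == i then (minn i c)%:R * b 0%N
  else if (i < j)%N then b (j - i + 1)%N
  else 0.

(* The q-matrix of M on {-1, 0, 1, ...}, the state -1 being None and n >= 0
   being Some n. *)
Definition qcat (R : realType) (c : nat) (b hs : nat -> R) (h beta : R)
    (x y : option nat) : R :=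
  match x, y with
  | None, _ => 0
  | Some i, None => if (0 < i)%N then beta else 0
  | Some i, Some j =>
      qtilde c b hs h i j - (if (i == j) && (0 < i)%N then beta else 0)
  end.

(* A Markov chain in continuous time with transition function p and
   right-continuous paths for the discrete topology on S. *)
Record markov_chain (R : realType) (dsp : measure_display)
    (Omega : measurableType dsp) (P : probability Omega R) (S : countType)
    (p : S -> S -> R -> R) (M : R -> Omega -> S) : Prop := MarkovChain {
  mc_measurable : forall t i, 0 <= t -> measurable [set w | M t w = i] ;
  mc_right_continuous : forall w t, 0 <= t ->
    \forall s \near t^'+, M s w = M t w ;
  mc_markov : forall (n : nat) (t : nat -> R) (i : nat -> S),
    0 <= t 0%N -> (forall k, (k <= n)%N -> t k < t k.+1) ->
    (P [set w | forall k, (k <= n.+1)%N -> M (t k) w = i k] =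
     P [set w | forall k, (k <= n)%N -> M (t k) w = i k] *
       (p (i n) (i n.+1) (t n.+1 - t n))%:E)%E
}.

(* First time at which M visits x; +oo when x is never visited. *)
Definition hitting_time (R : realType) (Omega S : Type)
    (M : R -> Omega -> S) (x : S) (w : Omega) : \bar R :=
  ereal_inf [set t%:E | t in [set t : R | 0 <= t /\ M t w = x]].

(* f is a density of the [0, +oo]-valued random time C, in the sense that
   P(C > t) = \int_t^oo f for all t >= 0; in particular C is a.s. finite. *)
Definition is_density (R : realType) (dsp : measure_display)
    (Omega : measurableType dsp) (P : probability Omega R)
    (C : Omega -> \bar R) (f : R -> R) : Prop :=
  [/\ measurable_fun (`[0, +oo[ : set R) f,
      forall t, 0 <= t -> 0 <= f t &
      forall t, 0 <= t ->
        (P [set w | t%:E < C w] =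
         \int[lebesgue_measure]_(tau in `[t, +oo[) (f tau)%:E)%E].

Definition laplace (R : realType) (f : R -> R) (lambda : R) : \bar R :=
  (\int[lebesgue_measure]_(t in `[0%R, +oo[) (expR (- (lambda * t)) * f t)%:E)%E.

(* The resolvent: r_ij(lambda) = \int_0^oo e^(-lambda t) p_ij(t) dt. *)
Definition resolvent (R : realType) (S : countType) (p : S -> S -> R -> R)
    (i j : S) (lambda : R) : R :=
  fine (laplace (p i j) lambda).

(* Main.v *)
Require Import Defs.
From HB Require Import structures.
From mathcomp Require Import all_boot all_order all_algebra.
From mathcomp Require Import all_classical all_reals all_analysis.
From mathcomp Require Import measurable_realfun ring lra.
Set Implicit Arguments.
Unset Strict Implicit.
Unset Printing Implicit Defensive.
Import Order.TTheory GRing.Theory Num.Theory.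
Import numFieldNormedType.Exports.
Local Open Scope classical_set_scope.
Local Open Scope ring_scope.

(** Let [mu = lambda + beta], let [r_i] be the resolvent entry [r~_{i0}(mu)]
    of the queue with resurrection, and let [u_i] be the Laplace transform at
    [lambda] of the time of the first catastrophe when the queue starts from
    [i].

    Absorption at [-1] (the state [None]) makes [P(C > t)] equal to [1 -
    p_{j,-1}(t)], where [p] is the transition function of [M]; this is where
    right-continuity of the paths enters ([hitting_time_tail]). By Tonelli,
    [u_j] is then [lambda] times the resolvent entry of [M] from [j] to [-1]
    ([laplace_density], [laplace_hitting_time_density]).

    The backward equations of the two chains ([resolvent_backward_series],
    [catastrophe_equations]) read, with [Q] the q-matrix of the queue, [mu r -
    Q r = delta_0] and [lambda u - Q u = beta (1 - u) 1_{i > 0}]. The second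
    one is rewritten as [mu u - Q u = beta - beta (1 - u_0) delta_0].
    Constants are harmonic for the conservative matrix [Q], so [beta / mu -
    beta (1 - u_0) r] solves the same equation as [u]; as [Q] is bounded, a
    bounded solution is unique ([bounded_generator_inj]). Evaluation at [0]
    determines [u_0], and evaluation at [j] gives the formula.

    The transition functions are only assumed to have the right q-matrix at
    time 0, so the backward equations have to be derived. This is done
    directly for the resolvents, from finite truncations of Chapman-Kolmogorov
    ([resolvent_backward]): the truncation error is controlled by the mass
    that a row of the q-matrix has outside the truncation, and tends to 0
    because the rows of [Q] sum to 0 ([qtilde_row]). *)

(** * Transition functions *)

Section transition_functions.
Context (R : realType) (S : countType) (p : S -> S -> R -> R).
Hypothesis tf : transition_function p.

Lemma esum_ge_seq (f : S -> \bar R) (F : seq S) : uniq F ->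
  (\sum_(k <- F) f k <= \esum_(k in [set: S]) f k)%E.
Proof.
move=> uF; apply: esum_ge; exists [set` F].
  by split => //; exact: finite_seq.
by rewrite fsbig_seq.
Qed.

Lemma tf_row_seq i t (F : seq S) : 0 <= t -> uniq F ->
  \sum_(k <- F) p i k t <= 1.
Proof.
move=> t0 uF; rewrite -lee_fin -sumEFin.
exact: le_trans (esum_ge_seq _ uF) (tf_row tf i t0).
Qed.

Lemma tf_le1 i k t : 0 <= t -> p i k t <= 1.
Proof.
by move=> t0; have := @tf_row_seq i t [:: k] t0 isT; rewrite big_seq1.
Qed.

Lemma tf_addt_ge i j s t (F : seq S) : 0 <= s -> 0 <= t -> uniq F ->
  \sum_(k <- F) p i k s * p k j t <= p i j (s + t).
Proof.
move=> s0 t0 uF.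
rewrite -lee_fin (tf_chapman_kolmogorov tf)// -sumEFin.
exact: esum_ge_seq.
Qed.

(** Whatever mass the row of [p] at time [s] leaves outside [F] can contribute
    at most itself, since every [p k j t] is at most 1. Together with
    [tf_addt_ge] this traps Chapman-Kolmogorov between finite sums, which can
    be integrated and differentiated term by term. *)
Lemma tf_addt_le i j s t (F : seq S) : 0 <= s -> 0 <= t -> uniq F ->
  p i j (s + t) <=
  \sum_(k <- F) p i k s * p k j t + (1 - \sum_(k <- F) p i k s).
Proof.
move=> s0 t0 uF.
have pge0 k : (0 <= (p i k s * p k j t)%:E)%E.
  by rewrite lee_fin mulr_ge0// (tf_ge0 tf).
have cge0 k : (0 <= (p i k s * (1 - p k j t))%:E)%E.
  by rewrite lee_fin mulr_ge0// ?(tf_ge0 tf)// subr_ge0 tf_le1.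
have : ((p i j (s + t))%:E + (\sum_(k <- F) p i k s * (1 - p k j t))%:E
        <= 1%:E)%E.
  rewrite (tf_chapman_kolmogorov tf)//.
  apply: le_trans (tf_row tf i s0).
  rewrite [leRHS](_ : _ = (\esum_(k in [set: S])
    ((p i k s * p k j t)%:E + (p i k s * (1 - p k j t))%:E))%E); last first.
    by apply: eq_esum => k _; rewrite -EFinD; congr EFin; ring.
  rewrite esumD// leeD2l// -sumEFin.
  exact: esum_ge_seq.
rewrite -EFinD lee_fin => H.
have -> : \sum_(k <- F) p i k s * p k j t + (1 - \sum_(k <- F) p i k s) =
          1 - \sum_(k <- F) p i k s * (1 - p k j t).
  have -> : \sum_(k <- F) p i k s * (1 - p k j t) =
     \sum_(k <- F) p i k s - \sum_(k <- F) p i k s * p k j t.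
    by rewrite -sumrB; apply: eq_bigr => k _; ring.
  by ring.
by rewrite lerBrDr.
Qed.

(** Both Chapman-Kolmogorov bounds with [F] reduced to the single state [i]:
    only the mass [1 - p i i s] is elsewhere than in [i] at time [s]. *)
Lemma tf_modulus i j s t : 0 <= s -> 0 <= t ->
  `|p i j (s + t) - p i j t| <= 1 - p i i s.
Proof.
move=> s0 t0.
have := @tf_addt_ge i j s t [:: i] s0 t0 isT.
have := @tf_addt_le i j s t [:: i] s0 t0 isT.
rewrite !big_seq1 => h1 h2.
have := tf_le1 i i s0; have := tf_le1 i j t0.
have := tf_ge0 tf i i s0; have := tf_ge0 tf i j t0 => a b c d.
rewrite ler_norml; apply/andP; split; nra.
Qed.

Lemma tf_continuous i j : {within `[0, +oo[, continuous (p i j)}.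
Proof.
have near0 (e : R) : 0 < e ->
    exists2 d, 0 < d & forall s, 0 <= s -> s < d -> 1 - p i i s < e.
  move=> e0.
  have := @tf_standard _ _ _ tf i i; rewrite eqxx => /cvgrPdist_lt /(_ e e0).
  case=> d /= d0 H; exists d => // s; rewrite le_eqVlt => /predU1P[<- _|s0 sd].
    by rewrite (tf_zero tf) eqxx subrr.
  apply: le_lt_trans (ler_norm _) _.
  by apply: H => //=; rewrite sub0r normrN gtr0_norm.
apply/subspace_continuousP => x /=; rewrite in_itv/= andbT => x0.
apply/cvgrPdist_lt => e e0; have [d d0 H] := near0 e e0.
exists d => //= y; rewrite in_itv/= andbT => xy y0.
have [xy'|/ltW yx] := leP x y.
- rewrite distrC; have -> : y = (y - x) + x by ring.
  apply: (le_lt_trans (tf_modulus _ _ _ x0)); rewrite ?subr_ge0//.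
  apply: H; rewrite ?subr_ge0//.
  by rewrite -(ger0_norm (_ : 0 <= y - x)) ?subr_ge0// distrC.
- have -> : x = (x - y) + y by ring.
  apply: (le_lt_trans (tf_modulus _ _ _ y0)); rewrite ?subr_ge0//.
  by apply: H; rewrite ?subr_ge0// -(ger0_norm (_ : 0 <= x - y)) ?subr_ge0.
Qed.

(** The defect [1 - p i i t] is subadditive in [t], hence at most [n] times
    its value at [t / n]; that product tends to [- t * q i i = 0]. *)
Lemma tf_absorbing (q : S -> S -> R) i : has_q_matrix p q -> q i i = 0 ->
  forall t, 0 <= t -> p i i t = 1.
Proof.
move=> hq qii t; rewrite le_eqVlt => /predU1P[<-|t0].
  by rewrite (tf_zero tf) eqxx.
apply/eqP; rewrite eq_le tf_le1 ?(ltW t0)//=.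
have sub n s : 0 <= s -> 1 - p i i (s *+ n) <= (1 - p i i s) *+ n.
  move=> s0; elim: n => [|n IH].
    by rewrite !mulr0n (tf_zero tf) eqxx subrr.
  have sn0 : 0 <= s *+ n by rewrite mulrn_wge0.
  have := @tf_addt_ge i i s (s *+ n) [:: i] s0 sn0 isT.
  rewrite big_seq1 -mulrS => h; rewrite [leRHS]mulrS.
  have := tf_le1 i i s0; have := tf_le1 i i sn0.
  by nra.
rewrite -subr_le0; apply/ler_addgt0Pl => e e0; rewrite addr0.
(* n.+1 is so large that the difference quotient at t / n.+1 is below e / t *)
have := hq i i; rewrite qii eqxx => /cvgrPdist_lt /(_ (e / t) (divr_gt0 e0 t0)).
case=> d /= d0 H.
pose n := Num.truncn (t / d).
have n1 : t / d < n.+1%:R by rewrite truncnS_gt.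
have n0 : (0 : R) < n.+1%:R by rewrite ltr0n.
have s0 : 0 < t / n.+1%:R by rewrite divr_gt0.
have sd : t / n.+1%:R < d.
  by rewrite ltr_pdivrMr// mulrC -ltr_pdivrMr.
have := H (t / n.+1%:R); rewrite /= !sub0r !normrN gtr0_norm// => /(_ sd s0).
rewrite mulr1n normrM normfV (gtr0_norm s0) distrC ger0_norm; last first.
  by rewrite subr_ge0 tf_le1 ?ltW.
rewrite ltr_pdivrMr// => H1.
have := sub n.+1 _ (ltW s0).
have -> : t / n.+1%:R *+ n.+1 = t.
  by rewrite -mulr_natr mulfVK// lt0r_neq0.
move=> /le_trans; apply.
rewrite -mulr_natr -ler_pdivlMr//; apply: (le_trans (ltW H1)).
by rewrite le_eqVlt; apply/orP; left; apply/eqP; field; rewrite !lt0r_neq0.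
Qed.

End transition_functions.

(** * Laplace transforms of functions with values in [0, 1] *)

Section laplace_transform.
Context (R : realType) (lambda : R).
Hypothesis lambda_gt0 : 0 < lambda.
Notation mu := (@lebesgue_measure R).
Notation weight := (fun t : R => expR (- (lambda * t))).
Implicit Types f g : R -> R.

Lemma weight_continuous : continuous weight.
Proof.
move=> x; apply: continuous_comp; last exact: continuous_expR.
by apply: continuousN; apply: continuousM => //; exact: cst_continuous.
Qed.

Lemma weight_measurable (D : set R) : measurable_fun D weight.
Proof.
apply: measurable_funTS; apply: continuous_measurable_fun.
exact: weight_continuous.
Qed.

Lemma integral_weight :
  (\int[mu]_(t in `[0%R, +oo[) (lambda * weight t)%:E = 1)%E.
Proof.
rewrite integral_mkcond -(integral_exponential_pdf lambda_gt0).
apply: eq_integral => x _.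
rewrite /exponential_pdf !patchE.
by case: ifPn => //; rewrite mulNr.
Qed.

Lemma laplace_cst1 : laplace (fun=> 1) lambda = (lambda^-1)%:E.
Proof.
have := integral_weight.
under eq_integral do rewrite EFinM.
rewrite ge0_integralZl//=; last 2 first.
- by apply/measurable_EFinP; exact: weight_measurable.
- by rewrite lee_fin ltW.
move=> /(congr1 (mule (lambda^-1)%:E)).
rewrite muleA -EFinM mulVf ?lt0r_neq0// mul1e mule1 => <-.
by apply: eq_integral => x _; rewrite mulr1.
Qed.

Lemma integrable_weight : mu.-integrable `[0, +oo[ (EFin \o weight).
Proof.
apply/integrableP; split.
  by apply/measurable_EFinP; exact: weight_measurable.
have := ltry (lambda^-1); rewrite -laplace_cst1; congr (_ < _)%E.
by apply: eq_integral => x _ /=; rewrite mulr1 ger0_norm// expR_ge0.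
Qed.

Lemma integrable_laplace f : measurable_fun (`[0, +oo[ : set R) f ->
  (forall t, 0 <= t -> 0 <= f t <= 1) ->
  mu.-integrable `[0, +oo[ (EFin \o (fun t => weight t * f t)).
Proof.
move=> mf f01; apply: (@le_integrable _ _ _ mu _ _ _ (EFin \o weight)) => //.
- apply/measurable_EFinP; apply: measurable_funM => //.
  exact: weight_measurable.
- move=> x /=; rewrite in_itv/= andbT => /f01 /andP[f0 f1].
  rewrite lee_fin ger0_norm ?mulr_ge0 ?expR_ge0// ger0_norm ?expR_ge0//.
  by rewrite ler_piMr// expR_ge0.
- exact: integrable_weight.
Qed.

Lemma Rlaplace_ge0 f : (forall t, 0 <= t -> 0 <= f t <= 1) ->
  0 <= fine (laplace f lambda).
Proof.
move=> f01; rewrite fine_ge0// integral_ge0// => x /=.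
rewrite in_itv/= andbT => /f01 /andP[f0 f1].
by rewrite lee_fin mulr_ge0// expR_ge0.
Qed.

Lemma le_Rlaplace f g :
  mu.-integrable `[0, +oo[ (EFin \o (fun t => weight t * f t)) ->
  mu.-integrable `[0, +oo[ (EFin \o (fun t => weight t * g t)) ->
  (forall t, 0 <= t -> f t <= g t) ->
  fine (laplace f lambda) <= fine (laplace g lambda).
Proof.
move=> fi gi fg; apply: le_Rintegral => // x /=.
by rewrite in_itv/= andbT => /fg h; rewrite ler_wpM2l// expR_ge0.
Qed.

Lemma Rlaplace_le f : measurable_fun (`[0, +oo[ : set R) f ->
  (forall t, 0 <= t -> 0 <= f t <= 1) ->
  fine (laplace f lambda) <= lambda^-1.
Proof.
move=> mf f01; rewrite -[leRHS](_ : fine (laplace (fun=> 1) lambda) = _);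
  last by rewrite laplace_cst1.
apply: le_Rlaplace; first exact: integrable_laplace.
  by apply: integrable_laplace => // t _; rewrite ler01 lexx.
by move=> t /f01 /andP[].
Qed.

(** Integrability is part of the conclusion because the induction on [F] needs
    it for the additivity of the real-valued integral. *)
Lemma Rlaplace_affine (I : Type) (F : seq I) (a : I -> R) (f : I -> R -> R) r :
  (forall k, measurable_fun (`[0, +oo[ : set R) (f k)) ->
  (forall k t, 0 <= t -> 0 <= f k t <= 1) ->
  let g t := \sum_(k <- F) a k * f k t + r in
  mu.-integrable `[0, +oo[ (EFin \o (fun t => weight t * g t)) /\
  fine (laplace g lambda) =
    \sum_(k <- F) a k * fine (laplace (f k) lambda) + r / lambda.
Proof.
move=> mf f01; elim: F => [|k F [IHi IHe]] /=.
  have i1 := integrable_weight.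
  have ir : mu.-integrable `[0, +oo[ (fun t => r%:E * (weight t)%:E)%E.
    exact: integrableZl.
  split.
    apply: eq_integrable ir => // x _ /=.
    by rewrite big_nil add0r -EFinM mulrC.
  rewrite big_nil add0r /laplace.
  transitivity (\int[mu]_(x in `[0, +oo[) (r * weight x)).
    by congr fine; apply: eq_integral => x _; rewrite big_nil add0r mulrC.
  rewrite RintegralZl//; congr (_ * _).
  rewrite -[RHS](_ : fine (laplace (fun=> 1) lambda) = _); last first.
    by rewrite laplace_cst1.
  by congr fine; apply: eq_integral => x _; rewrite mulr1.
have i1 := integrable_laplace (mf k) (f01 k).
have ia : mu.-integrable `[0, +oo[
    (EFin \o (fun t => a k * (weight t * f k t))).
  have ir : mu.-integrable `[0, +oo[
      (fun t => (a k)%:E * (weight t * f k t)%:E)%E by exact: integrableZl.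
  by apply: eq_integrable ir.
set g' := fun t => \sum_(k <- F) a k * f k t + r in IHi IHe *.
have gE t : weight t * (\sum_(j <- k :: F) a j * f j t + r) =
    a k * (weight t * f k t) + weight t * g' t.
  by rewrite /g' big_cons; ring.
split.
  have ir : mu.-integrable `[0, +oo[
      (fun t => (a k * (weight t * f k t))%:E + (weight t * g' t)%:E)%E.
    exact: integrableD.
  by apply: eq_integrable ir => // x _ /=; rewrite gE EFinD.
transitivity (\int[mu]_(x in `[0, +oo[)
    (a k * (weight x * f k x) + weight x * g' x)).
  by congr fine; apply: eq_integral => x _; rewrite gE.
rewrite RintegralD// RintegralZl//.
by rewrite big_cons -addrA -IHe.
Qed.

End laplace_transform.

Section shifted_laplace_transform.
Context (R : realType) (lambda : R).
Hypothesis lambda_gt0 : 0 < lambda.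
Notation mu := (@lebesgue_measure R).
Notation weight := (fun t : R => expR (- (lambda * t))).
Implicit Types f g : R -> R.

Lemma within_continuous_measurable f :
  {within `[0, +oo[, continuous f} -> measurable_fun (`[0, +oo[ : set R) f.
Proof. by move=> cf; apply: subspace_continuous_measurable_fun. Qed.

Lemma weightM_continuous f : {within `[0, +oo[, continuous f} ->
  {within `[0, +oo[, continuous (fun t => weight t * f t)}.
Proof.
move=> cf x; apply: continuousM; last exact: cf.
by apply: continuous_subspaceT; exact: weight_continuous.
Qed.

Lemma integrable_laplace_shift f (s : R) : {within `[0, +oo[, continuous f} ->
  (forall t, 0 <= t -> 0 <= f t <= 1) -> 0 <= s ->
  mu.-integrable `[0, +oo[ (EFin \o (fun t => weight t * f (s + t))).
Proof.
move=> cf f01 s0; have mf := within_continuous_measurable cf.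
apply: (@integrable_laplace _ _ lambda_gt0 (fun t => f (s + t))).
  apply: (measurable_comp _ _ mf) => //.
  - move=> _ [t /= + <-]; rewrite !in_itv/= !andbT => t0; exact: addr_ge0.
  - exact: measurable_funD.
by move=> t t0; rewrite f01// addr_ge0.
Qed.

(** The substitution [t := s + t] turns the shifted transform into [expR
    (lambda * s)] times the tail of the transform beyond [s]. *)
Lemma laplace_shift f (s : R) : {within `[0, +oo[, continuous f} ->
  (forall t, 0 <= t -> 0 <= f t <= 1) -> 0 <= s ->
  fine (laplace (fun t => f (s + t)) lambda) =
  expR (lambda * s) * (fine (laplace f lambda) -
    \int[mu]_(t in `[0, s]) (weight t * f t)).
Proof.
move=> cf f01 s0.
have mf := within_continuous_measurable cf.
have int_f := integrable_laplace lambda_gt0 mf f01.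
have D1 : derive1 (fun t : R => s + t) = cst 1.
  by apply/funext => z; rewrite derive1E derive_val add0r mulr1.
have shiftE : (\int[mu]_(t in `[s, +oo[) (weight t * f t)%:E =
   \int[mu]_(t in `[0%R, +oo[) (weight (s + t) * f (s + t))%:E)%E.
  rewrite -{1}(addr0 s).
  rewrite (@increasing_ge0_integration_by_substitutiony _ (fun t => s + t)).
  - by apply: eq_integral => x _ /=; rewrite D1 /= !fctE mulr1.
  - by move=> x y _ _; rewrite ltrD2l.
  - by rewrite D1 => x _; exact: cst_continuous.
  - by rewrite D1; exact: is_cvg_cst.
  - by rewrite D1; exact: is_cvg_cst.
  - split; first by move=> x _; exact: ex_derive.
    apply: cvg_at_right_filter; apply: cvgD; [exact: cvg_cst|exact: cvg_id].
  - exact: cvg_addrl.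
  - apply: continuous_subspaceW (weightM_continuous cf).
    by apply: subset_itvr; rewrite bnd_simp addr0.
  - move=> x; rewrite in_itv/= andbT addr0 => sx.
    have /f01/andP[? _] : 0 <= x by apply: le_trans s0 (ltW sx).
    by rewrite mulr_ge0// expR_ge0.
rewrite [fine (laplace f _)](_ : _ =
  \int[mu]_(t in `[0, +oo[) (weight t * f t))//.
rewrite Rintegral_itvB//.
rewrite Rintegral_itv_obnd_cbnd; last first.
  apply: integrableS int_f => //.
  by apply: subset_itvr; rewrite bnd_simp.
have int_fs := integrable_laplace_shift cf f01 s0.
have -> : \int[mu]_(t in `[s, +oo[) (weight t * f t) =
    expR (- (lambda * s)) * fine (laplace (fun t => f (s + t)) lambda).
  rewrite -RintegralZl// /Rintegral shiftE.
  congr fine; apply: eq_integral => x _.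
  by rewrite mulrA -expRD; congr (expR _ * _)%:E; ring.
by rewrite mulrA expRxMexpNx_1 mul1r.
Qed.

Lemma average_cvg f : {within `[0, +oo[, continuous f} ->
  s^-1 * \int[mu]_(t in `[0, s]) f t @[s --> 0^'+] --> f 0.
Proof.
move=> cf; have /continuous_within_itvcyP[_ cf0] := cf.
apply/cvgrPdist_le => e e0.
move/cvgrPdist_le : cf0 => /(_ e e0)[d /= d0 H].
exists d => //= s; rewrite /ball_/= sub0r normrN => sd s0.
rewrite gtr0_norm// in sd.
have int_f : mu.-integrable `[0, s] (EFin \o f).
  apply: continuous_compact_integrable; first exact: segment_compact.
  by apply: continuous_subspaceW cf; exact: subset_itvl.
have int_c (r : R) : mu.-integrable `[0, s] (EFin \o (fun=> r)).
  apply: continuous_compact_integrable; first exact: segment_compact.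
  by apply: continuous_subspaceT; exact: cst_continuous.
have cstE (r : R) : \int[mu]_(t in `[0, s]) r = r * s.
  by rewrite Rintegral_cst//= lebesgue_measure_itv/= lte_fin s0 sube0.
have bnd t : `[0, s]%classic t -> `|f 0 - f t| <= e.
  rewrite /= in_itv/= => /andP[]; rewrite le_eqVlt => /predU1P[<- _|t0 ts].
    by rewrite subrr normr0 ltW.
  apply: H => //=; rewrite sub0r normrN gtr0_norm//.
  exact: le_lt_trans ts sd.
have up : \int[mu]_(t in `[0, s]) f t <= (f 0 + e) * s.
  rewrite -cstE; apply: le_Rintegral => // t /bnd.
  by rewrite ler_norml => /andP[]; lra.
have lo : (f 0 - e) * s <= \int[mu]_(t in `[0, s]) f t.
  rewrite -cstE; apply: le_Rintegral => // t /bnd.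
  by rewrite ler_norml => /andP[]; lra.
rewrite mulrC ler_norml; apply/andP; split.
  by rewrite lerBrDl -lerBrDr opprK ler_pdivrMr.
by rewrite lerBlDr -lerBlDl ler_pdivlMr.
Qed.

(** Right derivative at [s = 0] of [laplace_shift]: differentiating the
    exponential factor gives [lambda * laplace f], and the integral over
    [0 <= t <= s] removes [f 0]. This is what replaces an integration by parts,
    which would require the transition functions to be differentiable. *)
Lemma laplace_shift_derivative f : {within `[0, +oo[, continuous f} ->
  (forall t, 0 <= t -> 0 <= f t <= 1) ->
  s^-1 * (fine (laplace (fun t => f (s + t)) lambda) - fine (laplace f lambda))
    @[s --> 0^'+] --> lambda * fine (laplace f lambda) - f 0.
Proof.
move=> cf f01; set L := fine (laplace f lambda).
have d_exp : s^-1 * (expR (lambda * s) - 1) @[s --> (0:R)^'+] --> lambda.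
  have D : is_derive (0 : R) 1 (fun s => expR (lambda * s)) lambda.
    apply: is_derive_eq.
    by rewrite mulr0 expR0 mul1r; exact: mulr1.
  have [dv dE] := D.
  rewrite -[X in _ --> X]dE.
  apply: cvg_trans (cvg_dnbhs_at_right dv).
  apply: near_eq_cvg; apply: nearW => s /=.
  by rewrite mulr0 expR0 addr0 [_%:A]mulr1.
have avg : s^-1 * \int[mu]_(t in `[0, s]) (weight t * f t)
    @[s --> (0:R)^'+] --> f 0.
  have := average_cvg (weightM_continuous cf).
  by rewrite mulr0 oppr0 expR0 mul1r.
have e1 : expR (lambda * s) @[s --> (0:R)^'+] --> (1 : R).
  have -> : (1 : R) = expR (lambda * 0) by rewrite mulr0 expR0.
  apply: (@cvg_at_right_filter _ _ (fun s => expR (lambda * s))).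
  have := @weight_continuous R (- lambda) 0.
  by under eq_fun do rewrite mulNr opprK.
have : s^-1 * (expR (lambda * s) - 1) * L -
    expR (lambda * s) * (s^-1 * \int[mu]_(t in `[0, s]) (weight t * f t))
    @[s --> (0:R)^'+] --> lambda * L - 1 * f 0.
  apply: cvgB; apply: cvgM => //; exact: cvg_cst.
rewrite mul1r; apply: cvg_trans; apply: near_eq_cvg.
near=> s; rewrite laplace_shift//; first by rewrite -/L; ring.
Unshelve. all: by end_near.
Qed.

End shifted_laplace_transform.

(** * Backward equations for the resolvent *)

Section backward_inequalities.
Context (R : realType) (S : countType) (p : S -> S -> R -> R) (q : S -> S -> R).
Hypotheses (tf : transition_function p) (pq : has_q_matrix p q).
Context (lambda : R) (lambda_gt0 : 0 < lambda).

Let p01 i j t : 0 <= t -> 0 <= p i j t <= 1.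
Proof. by move=> t0; rewrite (tf_ge0 tf)// (tf_le1 tf). Qed.

Let mp i j : measurable_fun (`[0, +oo[ : set R) (p i j).
Proof. by apply: within_continuous_measurable; exact: tf_continuous. Qed.

Let cp i j : {within `[0, +oo[, continuous (p i j)}.
Proof. exact: tf_continuous. Qed.

Lemma resolvent_ge0 i j : 0 <= resolvent p i j lambda.
Proof. by apply: Rlaplace_ge0; exact: p01. Qed.

Lemma resolvent_le i j : resolvent p i j lambda <= lambda^-1.
Proof. by apply: Rlaplace_le => //; exact: p01. Qed.

Lemma laplace_resolvent i j :
  laplace (p i j) lambda = (resolvent p i j lambda)%:E.
Proof.
rewrite /resolvent fineK//; apply: integrable_fin_num => //.
by apply: integrable_laplace => //; exact: p01.
Qed.

(** The backward equation [lambda r_ij - delta_ij = sum_k q_ik r_kj] in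
    truncated form. Integrating the two Chapman-Kolmogorov bounds against the
    exponential weight gives bounds for the transform of [p i j (s + t)];
    subtracting their value at [s = 0], dividing by [s] and letting [s] tend
    to 0 yields the claim. The error term vanishes along an exhausting
    sequence of sets [F] exactly when row [i] of [q] is conservative. *)
Lemma resolvent_backward i j (F : seq S) : uniq F -> i \in F ->
  \sum_(k <- F) q i k * resolvent p k j lambda <=
    lambda * resolvent p i j lambda - (i == j)%:R <=
  \sum_(k <- F) q i k * resolvent p k j lambda - (\sum_(k <- F) q i k) / lambda.
Proof.
move=> uF iF.
set x := fun k => resolvent p k j lambda.
set y := lambda * _ - _; change (\sum_(k <- F) q i k * x k <= y <=
  \sum_(k <- F) q i k * x k - (\sum_(k <- F) q i k) / lambda).
have dsum (z : S -> R) : \sum_(k <- F) (i == k)%:R * z k = z i.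
  rewrite (bigD1_seq i)//= eqxx mul1r big1 ?addr0// => k.
  by rewrite eq_sym => /negbTE->; rewrite mul0r.
pose A (s : R) := fine (laplace (fun t => p i j (s + t)) lambda).
have Ay : s^-1 * (A s - x i) @[s --> (0:R)^'+] --> y.
  have := laplace_shift_derivative lambda_gt0 (@cp i j) (@p01 i j).
  by rewrite (tf_zero tf).
have Dx (z : S -> R) : \sum_(k <- F) ((p i k s - (i == k)%:R) / s) * z k
    @[s --> (0:R)^'+] --> \sum_(k <- F) q i k * z k.
  apply: cvg_big => [|k _]; first exact: add_continuous.
  by apply: cvgM; [exact: pq|exact: cvg_cst].
have Dx' (z : S -> R) (s : R) :
    \sum_(k <- F) ((p i k s - (i == k)%:R) / s) * z k =
    s^-1 * (\sum_(k <- F) p i k s * z k - z i).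
  rewrite -(dsum z) -sumrB big_distrr/=; apply: eq_bigr => k _; ring.
have Dr : \sum_(k <- F) ((p i k s - (i == k)%:R) / s) * x k -
    (\sum_(k <- F) ((p i k s - (i == k)%:R) / s) * 1) / lambda
    @[s --> (0:R)^'+] --> \sum_(k <- F) q i k * x k -
    (\sum_(k <- F) q i k * 1) / lambda.
  by apply: cvgB => //; apply: cvgM => //; exact: cvg_cst.
have {Dr} : \sum_(k <- F) ((p i k s - (i == k)%:R) / s) * x k -
    (\sum_(k <- F) ((p i k s - (i == k)%:R) / s) * 1) / lambda
    @[s --> (0:R)^'+] --> \sum_(k <- F) q i k * x k -
    (\sum_(k <- F) q i k) / lambda.
  by under [X in _ - X / _]eq_bigr do rewrite -[q i _]mulr1.
move=> Dr.
have bounds (s : R) : 0 < s ->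
    \sum_(k <- F) p i k s * x k <= A s <=
    \sum_(k <- F) p i k s * x k + (1 - \sum_(k <- F) p i k s) / lambda.
  move=> s0; have s0' := ltW s0.
  have iA :=
    integrable_laplace_shift lambda_gt0 (@cp i j) (@p01 i j) s0'.
  have [i1 <-] := Rlaplace_affine lambda_gt0 F (p i ^~ s)
    (1 - \sum_(k <- F) p i k s) (fun k => mp k j) (fun k => @p01 k j).
  have [i2 ] := Rlaplace_affine lambda_gt0 F (p i ^~ s)
    0 (fun k => mp k j) (fun k => @p01 k j).
  rewrite mul0r addr0 => <-.
  apply/andP; split; apply: le_Rlaplace => // t t0.
    by rewrite addr0 (tf_addt_ge tf).
  by rewrite (tf_addt_le tf).
apply/andP; split.
- apply: ler_cvg_to (Dx x) Ay _; near=> s; have s0 : 0 < s by [].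
  rewrite Dx' ler_pM2l ?invr_gt0// lerB//.
  by have /andP[] := bounds s s0.
- apply: ler_cvg_to Ay Dr _; near=> s; have s0 : 0 < s by [].
  rewrite !Dx'.
  have -> : \sum_(k <- F) p i k s * 1 = \sum_(k <- F) p i k s.
    by apply: eq_bigr => k _; rewrite mulr1.
  have /andP[_ h] := bounds s s0.
  have le : s^-1 * (A s - x i) <= s^-1 * (\sum_(k <- F) p i k s * x k - x i +
      (1 - \sum_(k <- F) p i k s) / lambda).
    by rewrite ler_pM2l ?invr_gt0// addrAC lerB.
  by apply: le_trans le _; rewrite le_eqVlt; apply/orP; left; apply/eqP; ring.
Unshelve. all: by end_near.
Qed.

End backward_inequalities.

(** * Bounded conservative q-matrices and the queue *)

Section bounded_generator.
Context (R : realType) (q : nat -> nat -> R) (K mu : R).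
Hypothesis mu_gt0 : 0 < mu.
Hypothesis q_ge0 : forall i k, k != i -> 0 <= q i k.
Hypothesis q_row : forall i, series (q i) @ \oo --> 0.
Hypothesis q_diag : forall i, - q i i <= K.

Lemma offdiag_series (u : nat -> R) i n : (i < n)%N ->
  series u n - u i = \sum_(0 <= k < n | k != i) u k.
Proof.
move=> lin; rewrite /series/= (bigD1_seq i)/= ?iota_uniq//.
  by rewrite addrAC subrr add0r.
by rewrite mem_index_iota.
Qed.

Lemma generator_diag_le0 i : 0 <= - q i i.
Proof.
rewrite -[X in _ <= X]add0r.
have Hc : series (q i) n - q i i @[n --> \oo] --> 0 - q i i.
  by apply: cvgB => //; exact: cvg_cst.
apply: (ler_cvg_to (cvg_cst 0) Hc); near=> n.
rewrite offdiag_series//; last by near: n; exact: nbhs_infty_gt.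
by apply: sumr_ge0 => k; exact: q_ge0.
Unshelve. all: by end_near.
Qed.

(** The equation reads [(mu - q_ii) w_i = sum_(k != i) q_ik w_k], and the
    weights on the right have total mass [- q_ii]; hence [|w_i| <= - q_ii /
    (mu - q_ii) * B], and this factor increases with [- q_ii <= K]. *)
Lemma generator_contraction (w : nat -> R) (B : R) :
  (forall i, `|w i| <= B) ->
  (forall i, series (fun k => q i k * w k) @ \oo --> mu * w i) ->
  forall i, `|w i| <= K / (mu + K) * B.
Proof.
move=> wB wq i.
have B0 : 0 <= B by apply: le_trans (wB 0%N).
have diag := generator_diag_le0 i.
have bound : `|mu * w i - q i i * w i| <= B * (0 - q i i).
  have H1 : `|series (fun k => q i k * w k) n - q i i * w i| @[n --> \oo]
      --> `|mu * w i - q i i * w i|.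
    by apply: cvg_norm; apply: cvgB => //; exact: cvg_cst.
  have H2 : B * (series (q i) n - q i i) @[n --> \oo] --> B * (0 - q i i).
    by apply: cvgM; [exact: cvg_cst|apply: cvgB => //; exact: cvg_cst].
  apply: (ler_cvg_to H1 H2); near=> n.
  have lin : (i < n)%N by near: n; exact: nbhs_infty_gt.
  rewrite (offdiag_series (fun k => q i k * w k))// offdiag_series// mulr_sumr.
  apply: le_trans (ler_norm_sum _ _ _) _; apply: ler_sum => k ki.
  by rewrite normrM ger0_norm ?q_ge0// mulrC ler_wpM2r// q_ge0.
have K0 : 0 <= K := le_trans diag (q_diag i).
move: bound; rewrite -mulrBl normrM sub0r ger0_norm ?addr_ge0 ?(ltW mu_gt0)//.
set a := - q i i in diag *; have aK : a <= K := q_diag i.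
set v := `|w i| => bound.
rewrite mulrAC ler_pdivlMr ?ltr_pwDl//.
have v0 : 0 <= v := normr_ge0 _; have vB : v <= B := wB i.
have h : 0 <= (B - v) * (K - a) by rewrite mulr_ge0 ?subr_ge0.
by nra.
Unshelve. all: by end_near.
Qed.

(** Iterating the contraction: [mu - q] is injective on bounded sequences when
    [q] is a bounded conservative q-matrix. *)
Lemma bounded_generator_inj (w : nat -> R) (B : R) :
  (forall i, `|w i| <= B) ->
  (forall i, series (fun k => q i k * w k) @ \oo --> mu * w i) ->
  forall i, w i = 0.
Proof.
move=> wB wq i.
have iter n : forall i, `|w i| <= (K / (mu + K)) ^+ n * B.
  elim: n => [|n IH]; first by move=> k; rewrite expr0 mul1r.
  by rewrite exprS -mulrA; exact: generator_contraction.
have K0 : 0 <= K := le_trans (generator_diag_le0 i) (q_diag i).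
have rho1 : `|K / (mu + K)| < 1.
  rewrite ger0_norm ?divr_ge0 ?addr_ge0 ?(ltW mu_gt0)//.
  by rewrite ltr_pdivrMr ?ltr_pwDl// mul1r ltrDr.
apply/normr0_eq0/eqP; rewrite eq_le normr_ge0 andbT.
have H : (K / (mu + K)) ^+ n * B @[n --> \oo] --> 0.
  rewrite -[X in _ --> X](mul0r B); apply: cvgM; last exact: cvg_cst.
  exact: cvg_expr.
apply: (ler_cvg_to (cvg_cst `|w i|) H).
by apply: nearW => n; exact: iter.
Qed.

End bounded_generator.

Section queue_generator.
Context (R : realType) (c : nat) (b hs : nat -> R) (h : R).

Lemma nneseries_real_cvg (m : nat) (P : pred nat) (u : nat -> R) (l : R) :
  (forall j, P j -> (m <= j)%N -> 0 <= u j) ->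
  (l%:E = \sum_(m <= j <oo | P j) (u j)%:E)%E ->
  \sum_(m <= j < n | P j) u j @[n --> \oo] --> l.
Proof.
move=> u0 lE.
have : (\sum_(m <= j < n | P j) (u j)%:E)%E @[n --> \oo] --> l%:E.
  rewrite lE; apply: is_cvg_ereal_nneg_natsum_cond => n mn Pn.
  by rewrite lee_fin u0.
under eq_fun do rewrite sumEFin.
by move/fine_cvgP => [].
Qed.

Hypothesis hb_ge0 : forall j : nat, j != 1%N -> 0 <= b j.
Hypothesis hb_sum : ((- b 1%N)%:E = \sum_(0 <= j <oo | j != 1%N) (b j)%:E)%E.
Hypothesis hhs_ge0 : forall j, (1 <= j)%N -> 0 <= hs j.
Hypothesis hh_sum : (h%:E = \sum_(1 <= j <oo) (hs j)%:E)%E.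
Hypothesis h_gt0 : 0 < h.

Lemma qtilde_ge0 (i k : nat) : k != i -> 0 <= qtilde c b hs h i k.
Proof.
move=> ki; rewrite /qtilde; have [i0|_] := eqVneq i 0%N.
  by rewrite -i0 (negbTE ki) hhs_ge0// lt0n -i0.
rewrite (negbTE ki); case: ifP => _; first by rewrite mulr_ge0// hb_ge0.
case: ifP => // ik; apply: hb_ge0.
by rewrite addn1 eqSS subn_eq0 -ltnNge.
Qed.

Lemma qtilde_diag i : - qtilde c b hs h i i <= h - b 1%N + c%:R * b 0%N.
Proof.
have b0 : 0 <= b 0%N by exact: hb_ge0.
have b1 : 0 <= - b 1%N.
  rewrite -lee_fin hb_sum; apply: nneseries_ge0 => j _ j1.
  by rewrite lee_fin hb_ge0.
have cb : 0 <= c%:R * b 0%N by rewrite mulr_ge0.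
rewrite /qtilde eqxx; case: eqP => _; first by lra.
have : (minn i c)%:R * b 0%N <= c%:R * b 0%N.
  by rewrite ler_wpM2r// ler_nat geq_minr.
by move: (h_gt0); lra.
Qed.

(** The partial sums of row [i.+1] telescope onto the partial sums of [b]: the
    entries [minn i.+1 c * b 0] and [- (minn i.+1 c - 1) * b 0] leave [b 0].
    *)
Lemma qtilde_row i : series (qtilde c b hs h i) @ \oo --> 0.
Proof.
case: i => [|i].
  have E n : series (qtilde c b hs h 0) (n + 1)%N =
      - h + \sum_(1 <= k < n + 1) hs k.
    rewrite /series/= addn1 big_ltn// [X in X + _]/qtilde/=; congr (_ + _).
    by apply: eq_big_nat => k /andP[]; case: k.
  have H : - h + \sum_(1 <= k < n + 1) hs k @[n --> \oo] --> - h + h.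
    apply: cvgD; first exact: cvg_cst.
    have := nneseries_real_cvg (fun j _ => @hhs_ge0 j) hh_sum.
    by rewrite -(cvg_shiftn 1).
  rewrite addNr in H; rewrite -(cvg_shiftn 1); apply: cvg_trans H.
  by apply: near_eq_cvg; apply: nearW => n /=; rewrite E.
have E n : series (qtilde c b hs h i.+1) (n + i.+2)%N =
    \sum_(0 <= m < n + 2) b m.
  elim: n => [|n IH].
    rewrite add0n /series/= big_nat_recr//= big_nat_recr//=.
    rewrite big_nat_cond big1 ?add0r; last first.
      move=> k /[!andbT]/= ki; rewrite /qtilde/=.
      by rewrite eqSS !ltn_eqF ?ltnS ?(ltnW ki)// ltnNge ltnW// (leq_trans ki).
    rewrite /qtilde/= eqxx (ltn_eqF (ltnSn i)) add0n.
    rewrite !big_nat_recr//= big_geq// add0r.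
    by ring.
  rewrite !addSn seriesSr IH [RHS]big_nat_recr//=.
  congr (_ + _); rewrite /qtilde/=.
  have lt : (i.+1 < n + i.+2)%N by rewrite addnS ltnS leq_addl.
  rewrite gtn_eqF// gtn_eqF ?lt ?(ltnW lt)//; last exact: leqW.
  by rewrite -(addSnnS n) addnK addn1 addn2.
have H : \sum_(0 <= j < n + 2 | j != 1%N) b j + b 1%N @[n --> \oo] -->
    - b 1%N + b 1%N.
  apply: cvgD; last exact: cvg_cst.
  have := nneseries_real_cvg (fun j (jp : j != 1%N) _ => hb_ge0 jp) hb_sum.
  by rewrite -(cvg_shiftn 2).
rewrite addNr in H; rewrite -(cvg_shiftn i.+2); apply: cvg_trans H.
apply: near_eq_cvg; apply: nearW => n /=; rewrite E addrC.
rewrite -(bigD1_seq 1%N (F := b))/= ?iota_uniq//.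
by rewrite mem_index_iota addn2.
Qed.

End queue_generator.

(** * Laplace transform of a density *)

Section laplace_of_density.
Context (R : realType) (lambda : R).
Hypothesis lambda_gt0 : 0 < lambda.
Notation mu := (@lebesgue_measure R).
Notation weight := (fun t : R => expR (- (lambda * t))).
Variables d F : R -> R.
Hypothesis md : measurable_fun (`[0, +oo[ : set R) d.
Hypothesis d_ge0 : forall t, 0 <= t -> 0 <= d t.
Hypothesis mF : measurable_fun (`[0, +oo[ : set R) F.
Hypothesis F01 : forall t, 0 <= t -> 0 <= F t <= 1.
Hypothesis F0 : F 0 = 0.
Hypothesis tail : forall t, 0 <= t ->
  (\int[mu]_(tau in `[t, +oo[) (d tau)%:E = (1 - F t)%:E)%E.

Let d' := d \_ `[0, +oo[.

Let d'_ge0 t : 0 <= d' t.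
Proof.
by apply: restrict_ge0 => {}t /=; rewrite in_itv/= andbT; exact: d_ge0.
Qed.

Let md' : measurable_fun setT d'.
Proof. by apply: (measurable_restrictT _ _).1. Qed.

(** Tonelli's theorem is applied to this function on the plane. Integrating
    out the second variable gives [d t * (1 - expR (- lambda * t))];
    integrating out the first gives the exponential density times the tail of
    [d]. *)
Let joint (x : R * R) : \bar R :=
  (d' x.1 * exponential_pdf lambda x.2 * \1_[set y : R * R | y.2 <= y.1] x)%:E.

Let joint_ge0 x : (0 <= joint x)%E.
Proof.
by rewrite lee_fin !mulr_ge0// exponential_pdf_ge0// ltW.
Qed.

Let joint_measurable : measurable_fun setT joint.
Proof.
apply/measurable_EFinP; apply: measurable_funM.
  apply: measurable_funM; first exact: measurableT_comp.
  by apply: measurableT_comp => //; exact: measurable_exponential_pdf.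
apply: measurable_indic.
rewrite -[X in measurable X]setTI.
have : measurable_fun setT (fun y : R * R => y.2 <= y.1).
  by apply: measurable_fun_ler.
by move=> /(_ measurableT [set true] I); congr (measurable (_ `&` _)).
Qed.

Let indicE_le (x y : R) :
  \1_[set z : R * R | z.2 <= z.1] (x, y) = (y <= x)%R%:R :> R.
Proof.
rewrite indicE; congr (_%:R); congr nat_of_bool.
by apply/idP/idP => [/set_mem//|yx]; exact: mem_set.
Qed.

Let inner_exponential x :
  (\int[mu]_y joint (x, y) = (d' x * (1 - weight x))%:E)%E.
Proof.
have [x0|x0] := ltP x 0.
  rewrite /joint/= /d' patchE ifF; last first.
    apply/negbTE; rewrite notin_setE/= in_itv/= andbT.
    by apply/negP; rewrite -ltNge.
  by rewrite mul0r; apply: integral0_eq => y _; rewrite !mul0r.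
transitivity ((d' x)%:E *
    \int[mu]_(y in `[0%R, x]) (exponential_pdf lambda y)%:E)%E.
  rewrite -ge0_integralZl//=; last 3 first.
  - apply/measurable_EFinP; apply: measurable_funTS.
    exact: measurable_exponential_pdf.
  - by move=> y _; rewrite lee_fin exponential_pdf_ge0// ltW.
  - by rewrite lee_fin.
  rewrite [RHS]integral_mkcond; apply: eq_integral => y _.
  rewrite /joint patchE/= indicE_le.
  case: ifPn => [/set_mem|]; first rewrite /= in_itv/= => /andP[_ yx].
    by rewrite yx mulr1 EFinM.
  rewrite notin_setE/= in_itv/= => yx.
  have [y0|y0] := ltP y 0; first by rewrite lt0_exponential_pdf// mulr0 mul0r.
  by move: yx; rewrite y0/= => /negP/negbTE ->; rewrite mulr0.
rewrite -/(exponential_prob lambda `[0, x]).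
move: x0; rewrite le_eqVlt => /predU1P[<-|x0].
  rewrite set_itv1 /exponential_prob integral_set1 mule0.
  by rewrite mulr0 oppr0 expR0 subrr mulr0.
by rewrite exponential_prob_itv0c// mulNr -EFinB -EFinM.
Qed.

Let inner_tail y :
  (\int[mu]_x joint (x, y) = (exponential_pdf lambda y * (1 - F y))%:E)%E.
Proof.
have [y0|y0] := ltP y 0.
  rewrite lt0_exponential_pdf// mul0r; apply: integral0_eq => x _.
  by rewrite /joint/= lt0_exponential_pdf// mulr0 mul0r.
rewrite EFinM -tail// -ge0_integralZl//=; last 3 first.
- apply/measurable_EFinP; apply: measurable_funS md => //.
  by apply: subset_itvr; rewrite bnd_simp.
- move=> x /=; rewrite in_itv/= andbT => yx.
  by rewrite lee_fin d_ge0// (le_trans y0).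
- by rewrite lee_fin exponential_pdf_ge0// ltW.
rewrite [RHS]integral_mkcond; apply: eq_integral => x _.
rewrite /joint patchE/= indicE_le /d' patchE.
have [/set_mem|] := boolP (x \in (`[y, +oo[%classic : set R)); last first.
  rewrite notin_setE/= in_itv/= andbT => yx.
  by move/negP/negbTE: yx => ->; rewrite mulr0.
rewrite /= in_itv/= andbT => yx.
rewrite yx mulr1 ifT; first by rewrite mulrC EFinM.
by apply/mem_set; rewrite /= in_itv/= andbT (le_trans y0).
Qed.

(** Both [laplace d] and [lambda * laplace F] are complementary to the same
    double integral [X]: the former because [d] has mass 1, the latter because
    the exponential density has mass 1. *)
Lemma laplace_density : laplace d lambda = (lambda%:E * laplace F lambda)%E.
Proof.
pose X := (\int[mu]_(t in `[0%R, +oo[) (d t * (1 - weight t))%:E)%E.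
have weight_le1 t : 0 <= t -> weight t <= 1.
  by move=> t0; rewrite -[leRHS](@expR0 R) ler_expR oppr_le0 mulr_ge0// ltW.
have XE : X = (\int[mu]_(t in `[0%R, +oo[)
    (lambda * weight t * (1 - F t))%:E)%E.
  transitivity (\int[mu]_x \int[mu]_y joint (x, y))%E.
    rewrite /X integral_mkcond; apply: eq_integral => x _.
    rewrite inner_exponential /d' !patchE; case: ifPn => // _.
    by rewrite mul0r.
  rewrite (fubini_tonelli (m1 := mu) (m2 := mu) joint)//.
  rewrite [RHS]integral_mkcond; apply: eq_integral => y _.
  rewrite inner_tail /exponential_pdf !patchE; case: ifPn => [_|_].
    by rewrite mulNr.
  by rewrite mul0r.
have mw := @weight_measurable R lambda (`[0, +oo[ : set R).
have sum_d : (1 = laplace d lambda + X)%E.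
  have := tail (lexx 0); rewrite F0 subr0 => <-.
  rewrite /laplace /X -ge0_integralD//=; last 4 first.
  - move=> t; rewrite /= in_itv/= andbT => t0.
    by rewrite lee_fin mulr_ge0 ?expR_ge0// d_ge0.
  - by apply/measurable_EFinP; exact: measurable_funM.
  - move=> t; rewrite /= in_itv/= andbT => t0.
    by rewrite lee_fin mulr_ge0 ?d_ge0// subr_ge0 weight_le1.
  - apply/measurable_EFinP; apply: measurable_funM => //.
    exact: measurable_funB.
  by apply: eq_integral => t _; rewrite -EFinD; congr EFin; ring.
have sum_F : (1 = lambda%:E * laplace F lambda + X)%E.
  rewrite XE /laplace -ge0_integralZl//=; last 3 first.
  - by apply/measurable_EFinP; exact: measurable_funM.
  - move=> t; rewrite /= in_itv/= andbT => /F01/andP[F0' _].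
    by rewrite lee_fin mulr_ge0 ?expR_ge0.
  - by rewrite lee_fin ltW.
  rewrite -ge0_integralD//=; last 4 first.
  - move=> t; rewrite /= in_itv/= andbT => /F01/andP[F0' _].
    by rewrite mule_ge0 ?lee_fin ?mulr_ge0 ?expR_ge0// ltW.
  - apply/measurable_EFinP; apply: measurable_funM => //.
    exact: measurable_funM.
  - move=> t; rewrite /= in_itv/= andbT => /F01/andP[_ F1].
    by rewrite lee_fin !mulr_ge0 ?expR_ge0 ?subr_ge0// ltW.
  - apply/measurable_EFinP.
    apply: measurable_funM; first exact: measurable_funM.
    exact: measurable_funB.
  rewrite -[LHS](integral_weight lambda_gt0).
  by apply: eq_integral => t _; rewrite -EFinM -EFinD; congr EFin; ring.
have X_fin : X \is a fin_num.
  have L0 : (0 <= laplace d lambda)%E.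
    apply: integral_ge0 => t; rewrite /= in_itv/= andbT => t0.
    by rewrite lee_fin mulr_ge0 ?expR_ge0// d_ge0.
  have X0 : (0 <= X)%E.
    apply: integral_ge0 => t; rewrite /= in_itv/= andbT => t0.
    by rewrite lee_fin mulr_ge0 ?d_ge0// subr_ge0 weight_le1.
  rewrite ge0_fin_numE//; apply: le_lt_trans (ltry 1).
  by rewrite sum_d leeDr.
by rewrite -[LHS](addeK _ X_fin) -sum_d sum_F addeK.
Qed.

End laplace_of_density.

(** * Hitting time of an absorbing state *)

Section absorption_time.
Context (R : realType) (dsp : measure_display) (Omega : measurableType dsp).
Context (P : probability Omega R) (S : countType) (p : S -> S -> R -> R).
Context (M : R -> Omega -> S).
Hypothesis mc : markov_chain P p M.

Let mM t x : 0 <= t -> measurable [set w | M t w = x].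
Proof. by move=> t0; exact: (mc_measurable mc). Qed.

Lemma markov_two_times (s t : R) x y : 0 <= s -> s < t ->
  (P ([set w | M s w = x] `&` [set w | M t w = y]) =
   P [set w | M s w = x] * (p x y (t - s))%:E)%E.
Proof.
move=> s0 st.
have := mc_markov mc (n := 0) (t := fun k => if k is 0 then s else t)
  (fun k => if k is 0 then x else y) s0.
rewrite /= => H; transitivity (P [set w | forall k, (k <= 1)%N ->
    M (if k is 0 then s else t) w = (if k is 0 then x else y)]).
  congr (P _); apply/seteqP; split=> w /=.
    by move=> [? ?] [|[|]].
  by move=> h; split; [exact: (h 0%N)|exact: (h 1%N)].
rewrite H; last by case.
congr (P _ * _)%E; apply/seteqP; split=> w /=.
  by move=> /(_ 0%N isT).
by move=> ? [|].
Qed.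

Lemma markov_marginal i x t : 0 <= t -> transition_function p ->
  P [set w | M 0 w = i] = 1%E -> P [set w | M t w = x] = (p i x t)%:E.
Proof.
move=> t0 tf P0.
set B := [set w | M 0 w = i] in P0 *.
have mB : measurable B by exact: mM.
have nB : P (~` B) = 0%E by rewrite probability_setC// P0 subee.
have restrict A : measurable A -> P A = P (A `&` B).
  move=> mA; rewrite (measureDI P mA mB) [X in (X + _)%E](_ : _ = 0%E) ?add0e//.
  apply: (subset_measure0 _ _ _ nB); [exact: measurableD|exact: measurableC|].
  by move=> w [].
move: t0; rewrite le_eqVlt => /predU1P[<-|t0].
  rewrite (tf_zero tf); have [<-|ix] := eqVneq i x; first exact: P0.
  rewrite restrict; last exact: mM.
  rewrite (_ : _ `&` _ = set0) ?measure0//.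
  apply/seteqP; split=> w //= [+ H]; rewrite H => ixE.
  by move: ix; rewrite ixE eqxx.
rewrite restrict; last exact: mM (ltW t0).
by rewrite setIC markov_two_times// -/B P0 mul1e subr0.
Qed.

(** Right-continuity in a discrete state space: a visit to [x] lasts for a
    positive time, so every visit before [t] is seen at some rational time
    before [t]. The same argument at [t] excludes that visits accumulate at
    [t] from the right only. *)
Lemma hitting_time_le x w t : 0 <= t ->
  (hitting_time M x w <= t%:E)%E <->
  M t w = x \/
  exists q : rat, [/\ 0 <= (ratr q : R), ratr q < t & M (ratr q) w = x].
Proof.
move=> t0; split; last first.
  case=> [Mt|[q [q0 qt Mq]]].
    by apply: ereal_inf_lbound => /=; exists t.
  apply: (@le_trans _ _ (ratr q)%:E); last by rewrite lee_fin ltW.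
  by apply: ereal_inf_lbound => /=; exists (ratr q).
move=> le; have [?|/eqP Mt] := eqVneq (M t w) x; [by left|right].
have [e /= e0 He] := mc_right_continuous mc w t0.
have : (hitting_time M x w < (t + e)%:E)%E.
  by apply: le_lt_trans le _; rewrite lte_fin ltrDl.
move=> /ereal_inf_lt[_ [s [s0 Ms] <-]]; rewrite lte_fin => ste.
have st : s < t.
  rewrite ltNge le_eqVlt; apply/negP => /predU1P[ts|ts].
    by apply: Mt; rewrite ts.
  apply: Mt; rewrite -Ms; apply/esym/He => //=.
  by rewrite distrC gtr0_norm ?subr_gt0// ltrBlDl.
have [e' /= e'0 He'] := mc_right_continuous mc w s0.
have : s < Num.min t (s + e') by rewrite lt_min st ltrDl e'0.
move=> /rat_in_itvoo[q]; rewrite in_itv/= lt_min => /and3P[sq qt qe].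
exists q; split => //; first by rewrite (le_trans s0)// ltW.
rewrite -Ms; apply: He' => //=.
by rewrite distrC gtr0_norm ?subr_gt0// ltrBlDl.
Qed.

(** By [hitting_time_le] the event of having hit [x] by time [t] is a
    countable union of events [M q = x]; since [x] is absorbing each of them
    is, up to a null set, contained in [M t = x]. *)
Lemma hitting_time_tail x t : (forall s, 0 <= s -> p x x s = 1) -> 0 <= t ->
  P [set w | (t%:E < hitting_time M x w)%E] = (1 - P [set w | M t w = x])%E.
Proof.
move=> pxx t0.
pose D n := if unpickle n is Some q then
  if (0 <= (ratr q : R)) && (ratr q < t)
  then [set w | M (ratr q) w = x] else set0 else set0 : set Omega.
have mD n : measurable (D n).
  rewrite /D; case: unpickle => // q; case: ifP => // /andP[q0 _]; exact: mM.
set A := [set w | M t w = x]; have mA : measurable A by exact: mM.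
have complE : [set w | (t%:E < hitting_time M x w)%E] =
    ~` (A `|` \bigcup_n D n).
  apply/seteqP; split => w /=.
    rewrite ltNge => /negP nle H; apply: nle; apply/(hitting_time_le _ _ t0).
    case: H => [|[n _]]; [by left|rewrite /D].
    case: unpickle => // q; case: ifP => // /andP[q0 qt] /= Mq.
    by right; exists q.
  move=> H; rewrite ltNge; apply/negP => /(hitting_time_le _ _ t0) H'; apply: H.
  case: H' => [|[q [q0 qt Mq]]]; [by left|right].
  by exists (pickle q); [exact: I|rewrite /D pickleK q0 qt; exact: Mq].
have null n : P (D n `\` A) = 0%E.
  rewrite /D; case: unpickle => [q|]; last by rewrite set0D measure0.
  case: ifP => [/andP[q0 qt]|_]; last by rewrite set0D measure0.
  have mq : measurable [set w | M (ratr q) w = x] by exact: mM.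
  rewrite measureD//; last by rewrite ltey_eq fin_num_measure.
  rewrite [X in (_ - X)%E](_ : _ = P [set w | M (ratr q) w = x]).
    by rewrite subee// fin_num_measure.
  apply: etrans (markov_two_times x x q0 qt) _.
  by rewrite pxx ?mule1// subr_ge0 ltW.
have mU : measurable (\bigcup_n D n) by exact: bigcupT_measurable.
have nullU : P ((\bigcup_n D n) `\` A) = 0%E.
  have mDA n : measurable (D n `\` A) by exact: measurableD.
  have : P.-negligible (\bigcup_n (D n `\` A)).
    apply: negligible_bigcup => n; exists (D n `\` A).
    by split; [exact: mDA|exact: null|].
  move/measure_negligible; rewrite setDE setI_bigcupl; apply.
  exact: bigcupT_measurable.
rewrite complE probability_setC; last exact: measurableU.
congr (1 - _)%E.
rewrite -(measureU0 mA _ nullU); last exact: measurableD.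
by rewrite setUDr setDv setD0.
Qed.

(** Since [x] is absorbing, [p i x] is the distribution function of the hitting
    time of [x] from [i]. *)
Lemma laplace_hitting_time_density i x (d : R -> R) (lambda : R) :
  transition_function p -> (forall s, 0 <= s -> p x x s = 1) -> i != x ->
  P [set w | M 0 w = i] = 1%E -> is_density P (hitting_time M x) d ->
  0 < lambda ->
  laplace d lambda = (lambda * resolvent p i x lambda)%:E.
Proof.
move=> tf pxx ix P0 [md d0 tl] l0.
rewrite (laplace_density l0 md d0 (F := p i x)).
- by rewrite (laplace_resolvent tf l0).
- by apply: within_continuous_measurable; exact: tf_continuous.
- by move=> t t0; rewrite (tf_ge0 tf)// (tf_le1 tf).
- by rewrite (tf_zero tf) (negbTE ix).
- move=> t t0; rewrite -tl// (hitting_time_tail pxx t0).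
  by rewrite (markov_marginal _ t0 tf P0).
Qed.

End absorption_time.

(** * Resolvent equations of the two chains *)

Section resolvent_equations.
Context (R : realType).

Lemma squeezed_series (Q u : nat -> R) (l y : R) : Q @ \oo --> 0 ->
  (\forall n \near \oo, u n <= y <= u n - Q n / l) -> u @ \oo --> y.
Proof.
move=> Q0 H.
have Hl : y + Q n / l @[n --> \oo] --> y.
  rewrite -[X in _ --> X]addr0 -[X in _ --> _ + X](mul0r l^-1).
  apply: cvgD; first exact: cvg_cst.
  by apply: cvgM => //; exact: cvg_cst.
apply: (squeeze_cvgr _ Hl (cvg_cst y)); near=> n.
have /andP[h1 h2] : u n <= y <= u n - Q n / l by near: n.
by rewrite h1 andbT -lerBrDr.
Unshelve. all: by end_near.
Qed.

Lemma resolvent_absorbing (S : countType) (p : S -> S -> R -> R)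
    (lambda : R) x :
  0 < lambda -> (forall t, 0 <= t -> p x x t = 1) ->
  resolvent p x x lambda = lambda^-1.
Proof.
move=> l0 pxx.
rewrite -[RHS](_ : fine (laplace (fun=> 1) lambda) = _); last first.
  by rewrite laplace_cst1.
congr fine; apply: eq_integral => t; rewrite inE/= in_itv/= andbT => t0.
by rewrite pxx.
Qed.

Lemma resolvent_backward_series (q : nat -> nat -> R)
    (p : nat -> nat -> R -> R) (lambda : R) i j :
  series (q i) @ \oo --> 0 ->
  transition_function p -> has_q_matrix p q -> 0 < lambda ->
  series (fun k => q i k * resolvent p k j lambda) @ \oo -->
    lambda * resolvent p i j lambda - (i == j)%:R.
Proof.
move=> q_row tf pq l0.
apply: (squeezed_series (l := lambda) q_row); near=> n.
rewrite /series/=; apply: (resolvent_backward tf pq l0); first exact: iota_uniq.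
by rewrite mem_index_iota/=; near: n; exact: nbhs_infty_gt.
Unshelve. all: by end_near.
Qed.

(** Column [None] of the resolvent of the chain with catastrophes, multiplied
    by [lambda]. Its backward equation is that of the queue generator, except
    that every state [i > 0] is killed at rate [beta] and receives the
    boundary value 1 of the state [None] at the same rate. *)
Lemma catastrophe_equations (c : nat) (b hs : nat -> R) (h beta lambda : R)
    (pM : option nat -> option nat -> R -> R) :
  let q := qtilde c b hs h in
  let u i := lambda * resolvent pM (Some i) None lambda in
  let beta_ i := if (0 < i)%N then beta else 0 in
  (forall i, series (q i) @ \oo --> 0) ->
  transition_function pM -> has_q_matrix pM (qcat c b hs h beta) ->
  0 < lambda -> forall i,
  series (fun k => q i k * u k) @ \oo -->
    lambda * u i + beta_ i * (u i - 1).
Proof.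
move=> q u beta_ row hpM hqM hlambda i.
have absorbing t : 0 <= t -> pM None None t = 1.
  exact: (tf_absorbing hpM hqM).
have resNone := resolvent_absorbing hlambda absorbing.
pose x k := resolvent pM (Some k) None lambda.
have H : series (fun k => q i k * x k) @ \oo -->
    lambda * x i + beta_ i * (x i - lambda^-1).
  apply: (squeezed_series (l := lambda) (row i)); near=> n.
  have lin : (i < n)%N by near: n; exact: nbhs_infty_gt.
  (* the states None and Some k, k < n, exhaust the state space *)
  pose F := None :: [seq Some k | k <- index_iota 0 n].
  have uF : uniq F.
    rewrite /= map_inj_uniq ?iota_uniq ?andbT; last by move=> ? ? [].
    by apply/mapP => -[].
  have iF : Some i \in F.
    by rewrite inE/= map_f// mem_index_iota.
  have sumE (z : nat -> R) :
      \sum_(0 <= k < n) qcat c b hs h beta (Some i) (Some k) * z k =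
      series (fun k => q i k * z k) n - beta_ i * z i.
    rewrite /series/= [X in _ - X](_ : _ = \sum_(0 <= k < n)
      (if k == i then beta_ i * z i else 0)); last first.
      rewrite (bigD1_seq i)/= ?mem_index_iota ?iota_uniq// eqxx.
      by rewrite big1 ?addr0// => k /negbTE->.
    rewrite -sumrB; apply: eq_bigr => k _; rewrite /qcat eq_sym /beta_.
    case: (eqVneq k i) => [->|_] /=; last by rewrite subr0 subr0.
    by rewrite mulrBl.
  have := resolvent_backward hpM hqM hlambda None uF iF.
  rewrite /F !big_cons !big_map resNone sumE.
  have -> : \sum_(0 <= k < n) qcat c b hs h beta (Some i) (Some k) =
      series (q i) n - beta_ i.
    transitivity (\sum_(0 <= k < n) qcat c b hs h beta (Some i) (Some k) * 1).
      by apply: eq_bigr => k _; rewrite mulr1.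
    rewrite sumE mulr1; congr (_ - _).
    by apply: eq_bigr => k _; rewrite mulr1.
  rewrite -/(x i) /= -/(beta_ i) -/x subr0.
  set S := series (fun k => q i k * x k) n; set Q := series (q i) n.
  move=> /andP[h1 h2]; apply/andP; split; first by lra.
  have : (beta_ i + (Q - beta_ i)) / lambda = Q / lambda by congr (_ / _); ring.
  by lra.
rewrite (_ : lambda * u i + _ =
  lambda * (lambda * x i + beta_ i * (x i - lambda^-1))).
  have : lambda * series (fun k => q i k * x k) n @[n --> \oo] -->
    lambda * (lambda * x i + beta_ i * (x i - lambda^-1)).
    by apply: cvgM => //; exact: cvg_cst.
  apply: cvg_trans; apply: near_eq_cvg; apply: nearW => n.
  rewrite /series/= mulr_sumr; apply: eq_bigr => k _; rewrite /u -/(x k); ring.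
by rewrite /u -/(x i); field; rewrite gt_eqF.
Unshelve. all: by end_near.
Qed.

End resolvent_equations.

(** * The first catastrophe time *)

Theorem corollary4p2 (R : realType) (c : nat) (b hs : nat -> R) (h beta : R)
  (hc : (1 <= c)%N)
  (hb_ge0 : forall j : nat, j != 1%N -> 0 <= b j)
  (hb1 : 0 < - b 1%N)
  (hb_sum : ((- b 1%N)%:E = \sum_(0 <= j <oo | j != 1%N) (b j)%:E)%E)
  (hb0 : 0 < b 0%N)
  (hb2 : (0 < \sum_(2 <= j <oo) (b j)%:E)%E)
  (hbeta : 0 < beta)
  (hhs_ge0 : forall j, (1 <= j)%N -> 0 <= hs j)
  (hh_sum : (h%:E = \sum_(1 <= j <oo) (hs j)%:E)%E)
  (hh : 0 < h)
  (* the queue with resurrection, without catastrophes *)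
  (ptilde : nat -> nat -> R -> R)
  (hptilde : transition_function ptilde)
  (hqtilde : has_q_matrix ptilde (qtilde c b hs h))
  (* the chain M started from j, absorbed at -1 (None) by a catastrophe *)
  (pM : option nat -> option nat -> R -> R)
  (hpM : transition_function pM)
  (hqM : has_q_matrix pM (qcat c b hs h beta))
  (j : nat)
  (dsp : measure_display) (Omega : measurableType dsp)
  (P : probability Omega R) (M : R -> Omega -> option nat)
  (hM : markov_chain P pM M)
  (hM0 : P [set w | M 0 w = Some j] = 1%E)
  (* the density of the first effective catastrophe time C_{j0} *)
  (dj0 : R -> R)
  (hdj0 : is_density P (hitting_time M None) dj0)
  (lambda : R) (hlambda : 0 < lambda) :
  laplace dj0 lambda =
    (beta / (lambda + beta) -
     lambda / (lambda + beta) *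
       (beta * resolvent ptilde j 0%N (lambda + beta) /
        (1 - beta * resolvent ptilde 0%N 0%N (lambda + beta))))%:E.
Proof.
have absorbing t : 0 <= t -> pM None None t = 1.
  exact: (tf_absorbing hpM hqM).
rewrite (laplace_hitting_time_density hM hpM absorbing _ hM0 hdj0)//.
set mu := lambda + beta.
have mu0 : 0 < mu by rewrite addr_gt0.
pose r i := resolvent ptilde i 0%N mu.
pose u i := lambda * resolvent pM (Some i) None lambda.
pose q := qtilde c b hs h.
have row i : series (q i) @ \oo --> 0 by exact: qtilde_row.
have r_eq i : series (fun k => q i k * r k) @ \oo --> mu * r i - (i == 0%N)%:R.
  exact: resolvent_backward_series.
pose beta_ i := if (0 < i)%N then beta else 0.
have u_eq i : series (fun k => q i k * u k) @ \oo -->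
    lambda * u i + beta_ i * (u i - 1).
  exact: catastrophe_equations.
(* u solves mu u - q u = beta - beta (1 - u_0) delta_0, and so does
   beta / mu - beta (1 - u_0) r; w is the difference *)
pose w i := u i - beta / mu + beta * (1 - u 0%N) * r i.
have w_eq i : series (fun k => q i k * w k) @ \oo --> mu * w i.
  have -> : mu * w i = lambda * u i + beta_ i * (u i - 1) - (beta / mu) * 0 +
      beta * (1 - u 0%N) * (mu * r i - (i == 0%N)%:R).
    by rewrite /w /beta_ /mu; case: i => [|i] /=; field; rewrite gt_eqF.
  have : series (fun k => q i k * u k) n - (beta / mu) * series (q i) n +
      beta * (1 - u 0%N) * series (fun k => q i k * r k) n @[n --> \oo] -->
      lambda * u i + beta_ i * (u i - 1) - (beta / mu) * 0 +
      beta * (1 - u 0%N) * (mu * r i - (i == 0%N)%:R).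
    apply: cvgD; [apply: cvgB => //|]; apply: cvgM => //; exact: cvg_cst.
  apply: cvg_trans; apply: near_eq_cvg; apply: nearW => n.
  rewrite /series/= !mulr_sumr -sumrB -big_split/=; apply: eq_bigr => k _.
  by rewrite /w; ring.
have r0 i : 0 <= r i by exact: resolvent_ge0.
have r1 i : r i <= mu^-1 by exact: resolvent_le.
have u0 i : 0 <= u i by rewrite mulr_ge0 ?(ltW hlambda)//; exact: resolvent_ge0.
have u1 i : u i <= 1.
  by rewrite /u mulrC -ler_pdivlMr// mul1r; exact: resolvent_le.
have bmu : 0 <= beta / mu <= 1.
  rewrite divr_ge0 ?(ltW mu0) ?(ltW hbeta)//= ler_pdivrMr// mul1r.
  by rewrite lerDr ltW.
have w_bnd i : `|w i| <= 2.
  have t1 : 0 <= beta * r i <= beta / mu.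
    by rewrite mulr_ge0 ?(ltW hbeta)//= ler_pM2l.
  rewrite /w mulrAC.
  move: (u0 i) (u1 i) (u0 0%N) (u1 0%N) bmu t1.
  set A := beta * r i; set B := beta / mu; set C := u i; set D := u 0%N.
  move=> ? ? ? ? /andP[? ?] /andP[? ?].
  have ? : 0 <= A * (1 - D) <= A.
    rewrite mulr_ge0 ?subr_ge0//= ler_piMr//; lra.
  by rewrite ler_norml; apply/andP; split; lra.
have w_zero i : w i = 0.
  apply: (bounded_generator_inj mu0 _ row _ w_bnd w_eq) => [k l|k].
    exact: qtilde_ge0.
  exact: qtilde_diag.
have b_r : 1 - beta * r 0%N != 0.
  rewrite gt_eqF// subr_gt0; apply: (@le_lt_trans _ _ (beta / mu)).
    by rewrite ler_pM2l.
  by rewrite ltr_pdivrMr// mul1r ltrDr.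
congr EFin; rewrite -/(u j) -/(r j) -/(r 0%N).
have := w_zero j; have := w_zero 0%N; rewrite /w.
have mun : mu != 0 by rewrite gt_eqF.
have lE : lambda = mu - beta by rewrite /mu addrK.
move=> e0 ej.
(* w_0 = 0 is a linear equation for u_0, solvable because beta r_0 < 1 *)
have D0 : 1 - u 0%N = lambda / mu / (1 - beta * r 0%N).
  apply: (mulIf b_r); rewrite mulfVK//.
  have -> : lambda / mu = 1 - beta / mu by rewrite lE; field.
  by move: e0; nra.
have -> : u j = beta / mu - beta * (1 - u 0%N) * r j by lra.
by rewrite D0; field; rewrite mun b_r.
Unshelve. all: by end_near.
Qed.
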